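(* (1) Let $\alpha^{A'}\in\mathfrak S^+$ and $\beta^{A}\in\mathfrak S^-$ be two pure spinors of opposite chirality. Then the $\alpha$-plane associated to $\alpha^{A'}$ intersects the $\beta$-plane associated to $\beta^A$ in a totally null $(m-1)$-plane if and only if $$\alpha^{aA}\,\beta_a{}^{B'} = -2\,\alpha^{B'}\beta^{A},$$ where $\alpha^{aA}:=\gamma^a{}_{B'}{}^{A}\alpha^{B'}$ and $\beta^{aA'}:=\gamma^a{}_{B}{}^{A'}\beta^B$. (2) Let $\beta^{A},\rho^{A}\in\mathfrak S^-$ be any two negative pure spinors not proportional to each other. Then the $\beta$-planes associated to $\beta^A$ and $\rho^A$ intersect in a totally null $(m-2)$-plane if and only if $$\beta^{a(A'}\rho_a{}^{B')}=0,$$ where $\beta^{aA'}:=\gamma^a{}_{B}{}^{A'}\beta^B$ and $\rho^{aA'}:=\gamma^a{}_{B}{}^{A'}\rho^B$. The same result holds (with the roles of primed and unprimed indices exchanged) for any two positive pure spinors not proportional to each other.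
   Context: Let $m>2$ and let $\mathfrak V$ be a $2m$-dimensional oriented complex vector space with a non-degenerate symmetric bilinear form $g_{ab}$, used to raise and lower indices $a,b,\dots$. Round (square) brackets around indices denote symmetrisation (skew-symmetrisation) with normalising factor. $\mathfrak S^+$ and $\mathfrak S^-$ are the two $2^{m-1}$-dimensional chiral spinor spaces; elements of $\mathfrak S^+$ carry primed upper indices ($\xi^{A'}$) and elements of $\mathfrak S^-$ unprimed upper indices ($\zeta^A$). Clifford multiplication $\mathfrak V\otimes\mathfrak S^\pm\to\mathfrak S^\mp$ is given by matrices $\gamma_{aA'}{}^{B}$, $\gamma_{aA}{}^{B'}$ satisfying $$\gamma_{(a|A'}{}^{C}\gamma_{|b)C}{}^{B'}=-g_{ab}\delta_{A'}^{B'},\qquad \gamma_{(a|A}{}^{C'}\gamma_{|b)C'}{}^{B}=-g_{ab}\delta_A^B .$$ A non-zero spinor $\xi^{A'}\in\mathfrak S^+$ is pure if the kernel of the map $\mathfrak V\to\mathfrak S^-$, $v^a\mapsto v^a\gamma_{aB'}{}^A\xi^{B'}$ (which is always totally null) has dimension $m$; this kernel is the totally null $m$-plane (the $\alpha$-plane) associated to $\xi^{A'}$. Similarly a non-zero $\zeta^A\in\mathfrak S^-$ is pure if the kernel of $v^a\mapsto v^a\gamma_{aB}{}^{A'}\zeta^{B}$ has dimension $m$; this kernel is the $\beta$-plane associated to $\zeta^A$. (Self-dual totally null $m$-planes are called $\alpha$-planes, anti-self-dual ones $\beta$-planes; they correspond to positive and negative pure spinors up to scale respectively.) *)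

(* Defs.v *)
From HB Require Import structures.
From mathcomp Require Import all_boot all_order all_algebra.
From mathcomp Require Import reals.
From mathcomp Require Import complex.

Set Implicit Arguments.
Unset Strict Implicit.
Unset Printing Implicit Defensive.

Import GRing.Theory.
Local Open Scope ring_scope.

(* The complex numbers are R[i] for a realType R, vector spaces are vectTypes
   over R[i].  Clifford multiplication is the pair gp : V * S+ -> S-,
   gm : V * S- -> S+ of curried bilinear maps; all notions attached to a single
   chirality are defined for one such map gam : V * S -> T.  The orientation of
   V only decides which of the two half-spin spaces is called S+, so it is
   carried by the order of the pair (S+, S-). *)

Definition totally_null (R : realType) (V : vectType R[i])
    (g : {symmetric V}) (U : {vspace V}) : Prop :=
  {in U &, forall u v, g u v = 0}.

Definition null_plane (R : realType) (V : vectType R[i])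
    (g : {symmetric V}) (k : nat) (U : {vspace V}) : Prop :=
  totally_null g U /\ \dim U = k.

(* gamma_(a gamma_b) = - g_ab on S+ and on S-; the normalising factor of the
   symmetrisation is 1/2. *)
Definition clifford_relations (R : realType) (V Sp Sm : vectType R[i])
    (g : {symmetric V}) (gp : 'Hom(V, 'Hom(Sp, Sm)))
    (gm : 'Hom(V, 'Hom(Sm, Sp))) : Prop :=
  (forall (u v : V) (xi : Sp),
      2^-1 *: (gm v (gp u xi) + gm u (gp v xi)) = - g u v *: xi) /\
  (forall (u v : V) (zeta : Sm),
      2^-1 *: (gp v (gm u zeta) + gp u (gm v zeta)) = - g u v *: zeta).

(* The kernel of v |-> v . xi : the alpha-plane (gam = gp) or the beta-plane
   (gam = gm) of a pure spinor xi. *)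
Definition spinor_plane (R : realType) (V S T : vectType R[i])
    (gam : 'Hom(V, 'Hom(S, T))) (xi : S) : {vspace V} :=
  lker (linfun (fun v : V => gam v xi)).

Definition pure (R : realType) (m : nat) (V S T : vectType R[i])
    (gam : 'Hom(V, 'Hom(S, T))) (xi : S) : Prop :=
  xi != 0 /\ \dim (spinor_plane gam xi) = m.

Definition proportional (R : realType) (S : vectType R[i]) (xi eta : S) : Prop :=
  exists c : R[i], xi = c *: eta.

(* Index notation: components with respect to a frame e of V, and frames s of S
   and t of T.  Vector indices a, b range over 'I_n, spinor indices over 'I_p
   and 'I_q. *)

(* g_ab *)
Definition metric_mx (R : realType) (n : nat) (V : vectType R[i])
    (g : {symmetric V}) (e : n.-tuple V) : 'M[R[i]]_n :=
  \matrix_(a, b) g e`_a e`_b.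

(* gamma_{a B}^A *)
Definition gamma_lower (R : realType) (n p q : nat) (V S T : vectType R[i])
    (e : n.-tuple V) (s : p.-tuple S) (t : q.-tuple T)
    (gam : 'Hom(V, 'Hom(S, T))) (a : 'I_n) (B : 'I_p) (A : 'I_q) : R[i] :=
  coord t A (gam e`_a s`_B).

(* gamma^a_B^A = g^{ab} gamma_{b B}^A *)
Definition gamma_upper (R : realType) (n p q : nat) (V S T : vectType R[i])
    (g : {symmetric V}) (e : n.-tuple V) (s : p.-tuple S) (t : q.-tuple T)
    (gam : 'Hom(V, 'Hom(S, T))) (a : 'I_n) (B : 'I_p) (A : 'I_q) : R[i] :=
  \sum_(b < n) invmx (metric_mx g e) a b * gamma_lower e s t gam b B A.

(* xi^{aA} = gamma^a_B^A xi^B *)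
Definition spinor_upper (R : realType) (n p q : nat) (V S T : vectType R[i])
    (g : {symmetric V}) (e : n.-tuple V) (s : p.-tuple S) (t : q.-tuple T)
    (gam : 'Hom(V, 'Hom(S, T))) (xi : S) (a : 'I_n) (A : 'I_q) : R[i] :=
  \sum_(B < p) gamma_upper g e s t gam a B A * coord s B xi.

(* xi_a^A = g_ab xi^{bA} *)
Definition spinor_lower (R : realType) (n p q : nat) (V S T : vectType R[i])
    (g : {symmetric V}) (e : n.-tuple V) (s : p.-tuple S) (t : q.-tuple T)
    (gam : 'Hom(V, 'Hom(S, T))) (xi : S) (a : 'I_n) (A : 'I_q) : R[i] :=
  \sum_(b < n) metric_mx g e a b * spinor_upper g e s t gam xi b A.

(* X^{aA} Y_a^B, with the vector index summed over *)
Definition contract (R : realType) (n p q : nat)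
    (X : 'I_n -> 'I_p -> R[i]) (Y : 'I_n -> 'I_q -> R[i])
    (A : 'I_p) (B : 'I_q) : R[i] :=
  \sum_(a < n) X a A * Y a B.

(* T^{(AB)} *)
Definition symmetrise (R : realType) (p : nat) (T : 'I_p -> 'I_p -> R[i])
    (A B : 'I_p) : R[i] :=
  2^-1 * (T A B + T B A).

(* Main.v *)
(* Everything rests on one fact: since dim S+ + dim S- = 2^m, the joint kernel in
   S+ (+) S- of a totally null m-plane is a line.  For if x is null and
   orthogonal to X, and y is orthogonal to X with g(x,y) = 1, then x maps the
   joint kernel of X in S onto the joint kernel of x, X in T, so each step of a
   basis halves the total dimension.  Hence a pure spinor is determined up to scale
   by its plane N, N kills no non-zero spinor of the other chirality, and N is its
   own orthogonal complement.

   Then (m-1)-dimensional intersection means beta = v . alpha for some v, and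
   (m-2)-dimensional intersection means rho = x . y . beta for some x, y.  With
   v_A the vector such that g(v_A, u) = (u . xi)^A, the contraction
   xi^{aA} eta_a^B is (v_A . eta)^B, and v_A lies in the plane of xi when xi is
   pure, so moving v_A to the right gives the index identities.  Conversely, for
   beta^{aA} rho_a^B skew, N . rho is contained in V . beta; for v in the plane of
   rho and n in N with g(n,v) <> 0, rho is a multiple of
   n . v . rho + v . n . rho = v . (n . rho), hence of the form v . w . beta. *)

Require Import Defs.
From HB Require Import structures.
From mathcomp Require Import all_boot all_order all_algebra.
From mathcomp Require Import reals.
From mathcomp Require Import complex.
From mathcomp Require Import zify ring.

Set Implicit Arguments.
Unset Strict Implicit.
Unset Printing Implicit Defensive.

Import GRing.Theory Num.Theory.
Local Open Scope ring_scope.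

(** * Raising indices with the metric *)

Section Metric.

Variables (R : realType) (n : nat) (V : vectType R[i]) (g : {symmetric V}).
Hypothesis g_nondeg : nondegenerate g.

Lemma metricC u v : g u v = g v u.
Proof. by rewrite hermC expr0 mul1r. Qed.

Lemma metric_sumr (I : Type) (r : seq I) (P : pred I) (F : I -> V) u :
  g u (\sum_(i <- r | P i) F i) = \sum_(i <- r | P i) g u (F i).
Proof. exact: linear_sumr. Qed.

Lemma metricZr c u v : g u (c *: v) = c * g u v.
Proof. exact: linearZr_LR. Qed.

Lemma metric_inj u v : (forall w, g u w = g v w) -> u = v.
Proof.
move=> uv; apply/eqP; rewrite -subr_eq0 -memv0 -(eqP g_nondeg).
by apply/mem_orthovP => w _; rewrite linearBl /= uv subrr.
Qed.

Variables (e : n.-tuple V).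
Hypothesis he : basis_of fullv e.

(** A row vector killed by the Gram matrix gives a combination of the frame that is orthogonal to
    every vector. *)
Lemma metric_mx_unit : metric_mx g e \in unitmx.
Proof.
rewrite -row_free_unit -kermx_eq0; apply/rowV0P => x /sub_kermxP xG.
have x0 : \sum_i x 0 i *: e`_i = 0.
  apply: metric_inj => w; rewrite linear0l (coord_basis he (memvf w)).
  rewrite metric_sumr big1 // => j _; rewrite metricZr metricC.
  move/rowP/(_ j): xG; rewrite !mxE => xG.
  rewrite metric_sumr (eq_bigr (fun i => x 0 i * metric_mx g e i j)) ?xG ?mulr0 //.
  by move=> i _; rewrite metricZr mxE metricC.
by apply/rowP => i; rewrite mxE; apply: (freeP (basis_free he) _ x0).
Qed.

Lemma metric_mx_sym : (metric_mx g e)^T = metric_mx g e.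
Proof. by apply/matrixP => a b; rewrite !mxE metricC. Qed.

Lemma invmx_metric_sym a b :
  invmx (metric_mx g e) a b = invmx (metric_mx g e) b a.
Proof. by rewrite -{1}metric_mx_sym -trmx_inv mxE. Qed.

(** The vector with components g^{ab} h_b; [raiseE] characterises it without the frame. *)
Definition raise (h : 'Hom(V, R[i]^o)) : V :=
  \sum_(a < n) (\sum_(b < n) invmx (metric_mx g e) a b * h e`_b) *: e`_a.

Lemma raiseE h u : g (raise h) u = h u.
Proof.
rewrite (coord_basis he (memvf u)) metric_sumr linear_sum.
apply: eq_bigr => c _; rewrite metricZr linearZ; congr (_ * _).
rewrite metricC metric_sumr.
transitivity (\sum_b (metric_mx g e *m invmx (metric_mx g e)) c b * h e`_b).
  under eq_bigr do rewrite metricZr mulr_suml.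
  rewrite exchange_big; apply: eq_bigr => b _; rewrite mxE mulr_suml.
  by apply: eq_bigr => a _; rewrite mxE mulrC mulrA.
rewrite mulmxV ?metric_mx_unit // (bigD1 c) //= mxE eqxx mul1r big1 ?addr0 //.
by move=> b /negPf bc; rewrite mxE eq_sym bc mul0r.
Qed.

End Metric.

Lemma separating_vector (R : realType) (V : vectType R[i]) (g : {symmetric V})
    (g_nondeg : nondegenerate g) (U : {vspace V}) x : x \notin U ->
  exists2 y, {in U, forall u, g u y = 0} & g x y = 1.
Proof.
move=> xU; pose e := vbasis {:V}; have he : basis_of fullv e := vbasisP _.
(* [p] kills [U] but not [x], so some coordinate of [p] is a linear form separating [x] from [U];
   raised and rescaled it gives [y]. *)
pose p := (\1 - projv U)%VF.
have px : p x != 0.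
  rewrite add_lfunE opp_lfunE id_lfunE subr_eq0.
  by apply: contra xU => /eqP ->; apply: memv_proj.
have [i pxi] : exists i, coord e i (p x) != 0.
  apply/existsP; apply: contraNT px; rewrite negb_exists => /forallP px0.
  rewrite (coord_basis he (memvf (p x))) big1 // => i _.
  by have:= px0 i; rewrite negbK => /eqP ->; rewrite scale0r.
pose h : 'Hom(V, R[i]^o) := (linfun (coord e i : V -> R[i]^o) \o p)%VF.
have hE u : h u = coord e i (p u) by rewrite comp_lfunE lfunE.
exists ((coord e i (p x))^-1 *: raise g e h) => [u uU|];
  rewrite metricZr metricC (raiseE g_nondeg he) hE.
  have -> : p u = 0 by rewrite add_lfunE opp_lfunE id_lfunE projv_id ?subrr.
  by rewrite linear0 mulr0.
by rewrite mulVf.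
Qed.

(** * Index contractions as Clifford products *)

Section Contraction.

Variables (R : realType) (n p q : nat) (V S T : vectType R[i]).
Variables (g : {symmetric V}) (g_nondeg : nondegenerate g).
Variables (e : n.-tuple V) (he : basis_of fullv e).

Lemma spinor_upperE (s : p.-tuple S) (t : q.-tuple T) (gam : 'Hom(V, 'Hom(S, T)))
    (hs : basis_of fullv s) xi a A :
  spinor_upper g e s t gam xi a A =
  \sum_(b < n) invmx (metric_mx g e) a b * coord t A (gam e`_b xi).
Proof.
rewrite /spinor_upper /gamma_upper; under eq_bigr do rewrite mulr_suml.
rewrite exchange_big; apply: eq_bigr => b _ /=.
rewrite {2}(coord_basis hs (memvf xi)) !linear_sum /= mulr_sumr.
apply: eq_bigr => B _; rewrite !linearZ /= -mulrA; congr (_ * _).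
by rewrite mulrC.
Qed.

Lemma spinor_lowerE (s : p.-tuple S) (t : q.-tuple T) (gam : 'Hom(V, 'Hom(S, T)))
    (hs : basis_of fullv s) xi a A :
  spinor_lower g e s t gam xi a A = coord t A (gam e`_a xi).
Proof.
rewrite /spinor_lower; under eq_bigr do rewrite spinor_upperE // mulr_sumr.
rewrite exchange_big /=.
transitivity (\sum_c (metric_mx g e *m invmx (metric_mx g e)) a c
                * coord t A (gam e`_c xi)).
  apply: eq_bigr => c _; rewrite mxE mulr_suml.
  by apply: eq_bigr => b _; rewrite mulrA.
rewrite mulmxV ?metric_mx_unit // (bigD1 a) //= mxE eqxx mul1r big1 ?addr0 //.
by move=> b /negPf ba; rewrite mxE eq_sym ba mul0r.
Qed.

(* Carries the linear structure that [lfunE] needs to compute the [linfun] in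
   [spinor_plane]. *)
Definition clifford_act (gam : 'Hom(V, 'Hom(S, T))) xi (v : V) : T := gam v xi.

Fact clifford_act_is_linear gam xi : linear (clifford_act gam xi).
Proof.
by move=> c u v; rewrite /clifford_act linearP add_lfunE scale_lfunE.
Qed.

HB.instance Definition _ gam xi :=
  GRing.isLinear.Build _ _ _ _ (clifford_act gam xi) (clifford_act_is_linear gam xi).

Definition act_hom gam xi : 'Hom(V, T) := linfun (clifford_act gam xi).

Lemma act_homE gam xi v : act_hom gam xi v = gam v xi.
Proof. exact: lfunE. Qed.

Lemma mem_spinor_plane (gam : 'Hom(V, 'Hom(S, T))) xi v :
  (v \in spinor_plane gam xi) = (gam v xi == 0).
Proof. by rewrite -act_homE memv_ker. Qed.

(** With [A] fixed, the numbers xi^{aA} are the components of this vector, written v_A. *)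
Definition raised_act (t : q.-tuple T) gam xi (A : 'I_q) : V :=
  raise g e (linfun (coord t A : T -> R[i]^o) \o act_hom gam xi)%VF.

Lemma raised_actE t gam xi A u :
  g (raised_act t gam xi A) u = coord t A (gam u xi).
Proof. by rewrite raiseE // comp_lfunE lfunE /= act_homE. Qed.

End Contraction.

Section ContractionRaised.

Variables (R : realType) (n p q p' q' : nat) (V S T S' T' : vectType R[i]).
Variables (g : {symmetric V}) (g_nondeg : nondegenerate g).
Variables (e : n.-tuple V) (he : basis_of fullv e).
Variables (s : p.-tuple S) (t : q.-tuple T) (s' : p'.-tuple S') (t' : q'.-tuple T').
Hypotheses (hs : basis_of fullv s) (hs' : basis_of fullv s').

Lemma contract_raised (gam : 'Hom(V, 'Hom(S, T))) (gam' : 'Hom(V, 'Hom(S', T')))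
    xi eta A B :
  contract (spinor_upper g e s t gam xi) (spinor_lower g e s' t' gam' eta) A B =
  coord t' B (gam' (raised_act g e t gam xi A) eta).
Proof.
rewrite /raised_act /raise linear_sum sum_lfunE linear_sum; apply: eq_bigr => a _.
rewrite spinor_upperE // spinor_lowerE // linearZ scale_lfunE linearZ; congr (_ * _).
by apply: eq_bigr => b _; rewrite comp_lfunE lfunE /= act_homE.
Qed.

(** The inverse metric is symmetric, so either factor can be the one turned into a vector. *)
Lemma contractC (gam : 'Hom(V, 'Hom(S, T))) (gam' : 'Hom(V, 'Hom(S', T')))
    xi eta A B :
  contract (spinor_upper g e s t gam xi) (spinor_lower g e s' t' gam' eta) A B =
  contract (spinor_upper g e s' t' gam' eta) (spinor_lower g e s t gam xi) B A.
Proof.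
rewrite /contract.
under eq_bigr do rewrite spinor_upperE // spinor_lowerE // mulr_suml.
under [RHS]eq_bigr do rewrite spinor_upperE // spinor_lowerE // mulr_suml.
rewrite exchange_big; apply: eq_bigr => a _; apply: eq_bigr => b _ /=.
by rewrite invmx_metric_sym mulrAC.
Qed.

End ContractionRaised.

(** * Joint kernels of null vectors *)

Section Clifford.

Variables (R : realType) (V : vectType R[i]) (g : {symmetric V}).
Hypothesis g_nondeg : nondegenerate g.

Lemma clifford_sym (S T : vectType R[i]) (gs : 'Hom(V, 'Hom(S, T)))
    (gt : 'Hom(V, 'Hom(T, S))) :
  clifford_relations g gs gt -> clifford_relations g gt gs.
Proof. by case. Qed.

Section Vacuum.

Variables (S T : vectType R[i]) (gam : 'Hom(V, 'Hom(S, T))).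

(** A list instead of a subspace, so that induction can adjoin one null vector at a time. *)
Definition vacuum (X : seq V) : {vspace S} :=
  foldr (fun x U => U :&: lker (gam x))%VS fullv X.

Lemma vacuumP X xi : reflect {in X, forall x, gam x xi = 0} (xi \in vacuum X).
Proof.
elim: X => [|x X IH] /=; first by rewrite memvf; left.
rewrite memv_cap memv_ker; apply: (iffP andP) => [[/IH xiX /eqP xix] y | xiX].
  by rewrite inE => /predU1P [->|/xiX].
split; last by rewrite xiX ?mem_head.
by apply/IH => y yX; rewrite xiX // inE yX orbT.
Qed.

End Vacuum.

Section Relations.

Variables (S T : vectType R[i]) (gs : 'Hom(V, 'Hom(S, T))) (gt : 'Hom(V, 'Hom(T, S))).
Hypothesis cl : clifford_relations g gs gt.

Lemma cliffordC u v xi :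
  gt v (gs u xi) = - (2 * g u v) *: xi - gt u (gs v xi).
Proof.
have two0 : 2 != 0 :> R[i] by rewrite pnatr_eq0.
have [/(_ u v xi) rel _] := cl.
by rewrite -mulrN -scalerA -rel scalerA divff // scale1r addrK.
Qed.

Lemma clifford_sq u xi : gt u (gs u xi) = - g u u *: xi.
Proof.
case: cl => /(_ u u xi) <- _; set w := gt u _.
by rewrite -[in RHS](scale1r w) -scalerDl scalerA mulVf ?scale1r ?pnatr_eq0.
Qed.

Lemma spinor_plane_null xi : xi != 0 -> totally_null g (spinor_plane gs xi).
Proof.
move=> xi0 u v; rewrite !mem_spinor_plane => /eqP uxi /eqP vxi.
have := cliffordC u v xi; rewrite uxi vxi !linear0 addr0 => /esym/eqP.
by rewrite scaler_eq0 (negPf xi0) orbF oppr_eq0 mulf_eq0 pnatr_eq0 => /eqP.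
Qed.

End Relations.

(** Rank-nullity for multiplication by [x] on the joint kernel of [X] in [S]. *)
Lemma dim_vacuum_cons (S T : vectType R[i]) (gs : 'Hom(V, 'Hom(S, T)))
    (gt : 'Hom(V, 'Hom(T, S))) X x y :
  clifford_relations g gs gt ->
  g x x = 0 -> {in X, forall u, g x u = 0} ->
  {in X, forall u, g u y = 0} -> g x y = 1 ->
  \dim (vacuum gs X) = (\dim (vacuum gs (x :: X)) + \dim (vacuum gt (x :: X)))%N.
Proof.
move=> cl xx xX yX xy; rewrite -(limg_ker_dim (gs x) (vacuum gs X)).
congr (_ + \dim _)%N; apply/vspaceP => z; rewrite memv_cap memv_ker.
apply/memv_imgP/andP => [[xi /vacuumP xiX ->]|[/vacuumP zX /eqP xz]].
  split; last by rewrite (clifford_sq cl) xx oppr0 scale0r.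
  by apply/vacuumP => u uX;
    rewrite (cliffordC cl) xX // xiX // linear0 mulr0 oppr0 scale0r subr0.
have cl' := clifford_sym cl.
(* Since [x] kills [z] and g(x,y) = 1, x . y . z = -2 z. *)
exists (- 2^-1 *: gt y z).
  apply/vacuumP => u uX; rewrite linearZ /= (cliffordC cl') metricC yX //= zX //.
  by rewrite linear0 mulr0 oppr0 scale0r subr0 scaler0.
rewrite linearZ /= (cliffordC cl') metricC xy xz linear0 subr0 mulr1 /=.
by rewrite scalerA mulrNN mulVf ?scale1r ?pnatr_eq0.
Qed.

(** The same two kernels of the longer list occur in the counts for [S] and for [T], so adjoining a
    vector halves the total. *)
Lemma dim_vacuum (S T : vectType R[i]) (gs : 'Hom(V, 'Hom(S, T)))
    (gt : 'Hom(V, 'Hom(T, S))) X :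
  clifford_relations g gs gt -> free X -> {in X &, forall u v, g u v = 0} ->
  (2 ^ size X * (\dim (vacuum gs X) + \dim (vacuum gt X)) = \dim {:S} + \dim {:T})%N.
Proof.
move=> cl; elim: X => [|x X IH] /=; first by rewrite expn0 mul1n.
rewrite free_cons => /andP [xX freeX] null.
have [y yX xy] := separating_vector g_nondeg xX.
have nullX : {in X &, forall u v, g u v = 0}.
  by move=> u v uX vX; rewrite null // inE ?uX ?vX orbT.
have xx : g x x = 0 by rewrite null ?mem_head.
have gxX : {in X, forall u, g x u = 0}.
  by move=> u uX; rewrite null ?mem_head // inE uX orbT.
have yX' : {in X, forall u, g u y = 0}.
  by move=> u uX; rewrite yX // memv_span.
rewrite -(IH freeX nullX) (dim_vacuum_cons cl xx gxX yX' xy).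
rewrite (dim_vacuum_cons (clifford_sym cl) xx gxX yX' xy) /=.
set a := \dim (vacuum gs X :&: _); set b := \dim _.
by rewrite (addnC b a) addnn -mul2n mulnA -expnSr.
Qed.

Section MaximalNull.

Variables (m : nat) (S T : vectType R[i]).
Variables (gs : 'Hom(V, 'Hom(S, T))) (gt : 'Hom(V, 'Hom(T, S))).
Hypotheses (cl : clifford_relations g gs gt).
Hypothesis dimST : (\dim {:S} + \dim {:T} = 2 ^ m)%N.

Variable xi : S.
Hypothesis xi_pure : pure m gs xi.

Let N := spinor_plane gs xi.

(** The two dimensions add up to 1, and [xi] itself lies in the first kernel. *)
Lemma dim_vacuum_pure :
  (\dim (vacuum gs (vbasis N)) = 1 /\ \dim (vacuum gt (vbasis N)) = 0)%N.
Proof.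
have [xi0 dimN] := xi_pure.
have null : {in vbasis N &, forall u v, g u v = 0}.
  by move=> u v uN vN; apply: (spinor_plane_null cl xi0); apply: vbasis_mem.
have := dim_vacuum cl (basis_free (vbasisP N)) null.
have sizeN : size (vbasis N) = m by rewrite size_tuple.
rewrite sizeN dimST -[RHS]muln1 => /eqP.
rewrite eqn_pmul2l ?expn_gt0 // => /eqP dim1.
have : (0 < \dim (vacuum gs (vbasis N)))%N.
  rewrite lt0n dimv_eq0; apply: contraNneq xi0 => vac0.
  rewrite -memv0 -vac0; apply/vacuumP => u uN; apply/eqP.
  by rewrite -mem_spinor_plane vbasis_mem.
by move: (\dim (vacuum gs _)) (\dim (vacuum gt _)) dim1 => [|[|a]] [|b].
Qed.

Lemma pure_unique eta : {in N, forall v, gs v eta = 0} -> proportional eta xi.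
Proof.
have [xi0 _] := xi_pure; have [dim1 _] := dim_vacuum_pure => etaN.
have xiN : xi \in vacuum gs (vbasis N).
  apply/vacuumP => u uN; apply/eqP; by rewrite -mem_spinor_plane vbasis_mem.
have : eta \in vacuum gs (vbasis N).
  by apply/vacuumP => u uN; rewrite etaN // vbasis_mem.
suff -> : vacuum gs (vbasis N) = <[xi]>%VS by move/vlineP.
by apply/esym/eqP; rewrite eqEdim -memvE xiN dim1 dim_vline xi0.
Qed.

Lemma pure_chiral zeta : {in N, forall v, gt v zeta = 0} -> zeta = 0.
Proof.
have [_ /eqP] := dim_vacuum_pure; rewrite dimv_eq0 => /eqP vac0 zetaN.
apply/eqP; rewrite -memv0 -vac0; apply/vacuumP => u uN.
by rewrite zetaN // vbasis_mem.
Qed.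

(** [N] anticommutes with [v] and kills [xi], so it kills v . xi, which has the other chirality and
    must vanish. *)
Lemma orthogonal_spinor_plane v : {in N, forall u, g v u = 0} -> v \in N.
Proof.
move=> vN; rewrite mem_spinor_plane; apply/eqP/pure_chiral => u uN.
move: (uN); rewrite (cliffordC cl) vN // mem_spinor_plane => /eqP ->.
by rewrite linear0 mulr0 oppr0 scale0r subr0.
Qed.

End MaximalNull.

End Clifford.

(** * Adding lines to a subspace *)

Lemma dim_add_vline (K : fieldType) (V : vectType K) (U : {vspace V}) x :
  x \notin U -> \dim (U + <[x]>) = (\dim U).+1.
Proof.
move=> xU; apply/eqP; rewrite eqn_leq; apply/andP; split.
  apply: leq_trans (dimv_add_leqif U <[x]>) _.
  by rewrite dim_vline -addn1 leq_add2l leq_b1.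
rewrite (ltn_leqif (dimv_leqif_sup (addvSl U <[x]>))).
by rewrite subv_add subvv -memvE.
Qed.

Lemma add_vline_eq (K : fieldType) (V : vectType K) (U W : {vspace V}) x :
  (U <= W)%VS -> (\dim W <= (\dim U).+1)%N -> x \in W -> x \notin U ->
  (U + <[x]>)%VS = W.
Proof.
move=> UW dimW xW xU; apply/eqP.
by rewrite eqEdim subv_add UW -memvE xW dim_add_vline.
Qed.

Lemma add_two_vlines (K : fieldType) (V : vectType K) (U W : {vspace V}) y :
  (U <= W)%VS -> \dim W = (\dim U).+2 -> y \in W -> y \notin U ->
  exists x, [/\ x \in W, x \notin (U + <[y]>)%VS & (U + <[y]> + <[x]>)%VS = W].
Proof.
move=> UW dimW yW yU.
have dimUy : \dim (U + <[y]>) = (\dim U).+1 by apply: dim_add_vline.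
have UyW : (U + <[y]> <= W)%VS by rewrite subv_add UW -memvE.
have /subvPn [x xW xUy] : ~~ (W <= U + <[y]>)%VS.
  by apply/negP => /dimvS; rewrite dimW dimUy ltnn.
by exists x; split=> //; apply: add_vline_eq => //; rewrite dimW dimUy.
Qed.

(** * Planes meeting in codimension one and two *)

Section PureSpinors.

Variables (R : realType) (m : nat) (V S T : vectType R[i]) (g : {symmetric V}).
Hypothesis g_nondeg : nondegenerate g.
Variables (gs : 'Hom(V, 'Hom(S, T))) (gt : 'Hom(V, 'Hom(T, S))).
Hypotheses (cl : clifford_relations g gs gt).
Hypothesis dimST : (\dim {:S} + \dim {:T} = 2 ^ m)%N.

Let clt := clifford_sym cl.

Let dimTS : (\dim {:T} + \dim {:S} = 2 ^ m)%N.
Proof. by rewrite addnC. Qed.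

Let two_neq0 : 2 != 0 :> R[i].
Proof. by rewrite pnatr_eq0. Qed.

(** [n] is moved to the right until it kills [xi]. The result is skew in [x] and [y], the source of
    the skew contraction. *)
Lemma clifford_past_pair n x y xi : gs n xi = 0 ->
  gs n (gt x (gs y xi)) = (2 * g y n) *: gs x xi - (2 * g x n) *: gs y xi.
Proof.
move=> nxi; rewrite (cliffordC clt) (cliffordC cl) nxi linear0 subr0.
have -> : gs x (- (2 * g y n) *: xi) = - ((2 * g y n) *: gs x xi).
  by rewrite scaleNr linearN linearZ.
by rewrite opprK scaleNr addrC.
Qed.

(** [W] is its intersection with the plane of [xi] plus the line of [x]. The former anticommutes
    with [x] and kills [xi]; [x] squares to zero. *)
Lemma adjacent_plane_killed xi (W : {vspace V}) x :
  totally_null g W -> (\dim W <= (\dim (spinor_plane gs xi :&: W)).+1)%N ->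
  x \in W -> x \notin spinor_plane gs xi ->
  {in W, forall v, gt v (gs x xi) = 0}.
Proof.
move=> nullW dimW xW xN v vW; move: (vW).
have xL : x \notin (spinor_plane gs xi :&: W)%VS.
  by rewrite memv_cap negb_and xN.
rewrite -(add_vline_eq (capvSr _ _) dimW xW xL).
case/memv_addP => l lL [_ /vlineP [c ->] ->].
move: lL; rewrite memv_cap mem_spinor_plane => /andP [/eqP lxi lW].
rewrite linearD linearZ add_lfunE scale_lfunE (cliffordC cl) (clifford_sq cl) lxi.
by rewrite !nullW // linear0 mulr0 oppr0 !scale0r scaler0 subr0 addr0.
Qed.

Lemma null_cap xi (U : {vspace V}) :
  xi != 0 -> totally_null g (spinor_plane gs xi :&: U)%VS.
Proof.
move=> xi0 u v; rewrite !memv_cap => /andP [uN _] /andP [vN _].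
exact: (spinor_plane_null cl xi0).
Qed.

Lemma opposite_planes_adjacentP alpha beta :
  (0 < m)%N -> pure m gs alpha -> pure m gt beta ->
  null_plane g (m - 1) (spinor_plane gs alpha :&: spinor_plane gt beta) <->
  exists v, beta = gs v alpha.
Proof.
move=> m0 pa pb; have [a0 dima] := pa; have [b0 dimb] := pb; split.
  case=> _ dimL.
  have /subvPn [x xN' xN] : ~~ (spinor_plane gt beta <= spinor_plane gs alpha)%VS.
    by apply/negP => /capv_idPr NN; move: dimL; rewrite NN dimb; lia.
  (* x . alpha is killed by the plane of [beta], hence equals c beta, with c non-zero because [x]
     lies outside the plane of [alpha]. *)
  have := adjacent_plane_killed (spinor_plane_null clt b0) _ xN' xN.
  rewrite dimb dimL => /(_ _)/(pure_unique g_nondeg clt dimTS pb) [|c xa].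
    by rewrite subn1 prednK.
  exists (c^-1 *: x); rewrite linearZ scale_lfunE xa scalerA mulVf ?scale1r //.
  by apply: contra xN => /eqP c0; rewrite mem_spinor_plane xa c0 scale0r.
case=> v bE; split; first exact: null_cap.
set L := (_ :&: _)%VS.
have le_m : (\dim L <= m)%N by rewrite -dima dimvS ?capvSl.
(* Vectors of the plane of [alpha] orthogonal to [v] also kill v . alpha; this condition costs at
   most one dimension. *)
have ge_m : (m.-1 <= \dim L)%N.
  rewrite -dima; apply: leq_trans (leq_dim_orthov1 g v _) _.
  apply: dimvS; apply/subvP => u; rewrite [in X in X -> _]memv_cap mem_orthov1.
  move=> /andP [uN /eqP uv]; rewrite memv_cap; apply/andP; split=> [//|].
  rewrite mem_spinor_plane.
  have ua : gs u alpha = 0 by apply/eqP; rewrite -mem_spinor_plane.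
  by rewrite bE (cliffordC cl) metricC uv ua !(mulr0, linear0, oppr0, scale0r, addr0).
(* Otherwise the plane of [alpha] would kill [beta], a non-zero spinor of the other chirality. *)
have ne_m : \dim L <> m.
  move=> dimL; have NN' : (spinor_plane gs alpha <= spinor_plane gt beta)%VS.
    apply/capv_idPl/eqP; rewrite eqEdim capvSl /= dima.
    by rewrite -[X in (X <= _)%N]dimL leqnn.
  move/eqP: b0; apply; apply: (pure_chiral g_nondeg cl dimST pa) => u /(subvP NN').
  by rewrite mem_spinor_plane => /eqP.
by move: le_m ge_m ne_m; lia.
Qed.

Lemma same_planes_adjacentP beta rho :
  (1 < m)%N -> pure m gs beta -> pure m gs rho -> ~ proportional beta rho ->
  null_plane g (m - 2) (spinor_plane gs beta :&: spinor_plane gs rho) <->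
  exists x y, rho = gt x (gs y beta).
Proof.
move=> m1 pb pr bNr; have [b0 dimb] := pb; have [r0 dimr] := pr.
have /subvPn [y yN' yN] : ~~ (spinor_plane gs rho <= spinor_plane gs beta)%VS.
  apply/negP => /subvP N'N; apply: bNr.
  apply: (pure_unique g_nondeg cl dimST pr) => u /N'N.
  by rewrite mem_spinor_plane => /eqP.
have nullr := spinor_plane_null cl r0.
have N'_rho := @pure_unique _ _ _ g_nondeg _ _ _ _ _ cl dimST _ pr.
have N'_0 := @pure_chiral _ _ _ g_nondeg _ _ _ _ _ cl dimST _ pr.
have N_orth := @orthogonal_spinor_plane _ _ _ g_nondeg _ _ _ _ _ cl dimST _ pb.
have N'_adj := @adjacent_plane_killed beta _ _ nullr _ yN' yN.
have nullL := @null_cap beta (spinor_plane gs rho) b0.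
have LN := capvSl (spinor_plane gs beta) (spinor_plane gs rho).
have LN' := capvSr (spinor_plane gs beta) (spinor_plane gs rho).
have memL u := memv_cap u (spinor_plane gs beta) (spinor_plane gs rho).
have memN := mem_spinor_plane gs beta; have memN' := mem_spinor_plane gs rho.
(* The planes are made abstract here because unification attempts between the
   planes of beta and rho unfold [lker] and practically diverge. *)
set L := (_ :&: _)%VS in nullL LN LN' memL N'_adj *; clearbody L.
set N := spinor_plane gs beta in dimb yN N_orth LN memL memN *; clearbody N.
set N' := spinor_plane gs rho
  in dimr yN' nullr N'_rho N'_0 LN' memL memN' N'_adj *; clearbody N'.
split.
  case=> _ dimL.
  have yL : y \notin L by rewrite memL negb_and yN.
  have dimN' : \dim N' = (\dim L).+2 by rewrite dimr dimL -addn2 subnK.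
  have [x [xN' xLy N'E]] := add_two_vlines LN' dimN' yN' yL.
  have LyN' : (L + <[y]> <= N')%VS by rewrite subv_add LN' -memvE.
  (* Vectors of [L + <[y]>] kill y . beta and anticommute with [x], while [x] squares to zero. *)
  have : {in N', forall v, gs v (gt x (gs y beta)) = 0}.
    move=> v; rewrite -N'E => /memv_addP [w wLy [_ /vlineP [c ->] ->]].
    have wN' := subvP LyN' _ wLy.
    move: wLy wN' => /memv_addP [l lL [_ /vlineP [d ->] ->]] wN'.
    have lN' := subvP LN' _ lL.
    have lb : gs l beta = 0 by move: lL; rewrite memL memN => /andP [/eqP].
    have lyb : gt (l + d *: y) (gs y beta) = 0.
      rewrite linearD linearZ add_lfunE scale_lfunE (cliffordC cl) (clifford_sq cl) lb.
      by rewrite !nullr // !(mulr0, linear0, oppr0, scale0r, scaler0, addr0).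
    rewrite linearD linearZ add_lfunE scale_lfunE (cliffordC clt) (clifford_sq clt) lyb.
    by rewrite !nullr // !(mulr0, linear0, oppr0, scale0r, scaler0, addr0).
  case/N'_rho => c xyb.
  (* If x . y . beta = 0, applying some [n] in [N] with g(y,n) non-zero shows that w = g(y,n) x -
     g(x,n) y kills [beta]. Then [w] is in [L], so [x] is in [L + <[y]>], against its choice. *)
  have c0 : c != 0.
    apply/eqP => c0; move: xyb; rewrite c0 scale0r => xyb.
    have : y \notin orthov g N.
      apply: contra yN => /mem_orthovP yo.
      exact: N_orth.
    case/mem_orthovPn => n nN gyn.
    have nb : gs n beta = 0 by apply/eqP; rewrite -memN.
    pose w := g y n *: x - g x n *: y.
    have wL : w \in L.
      rewrite memL (rpredB (rpredZ _ xN') (rpredZ _ yN')) andbT memN.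
      have -> : gs w beta = g y n *: gs x beta - g x n *: gs y beta.
        by rewrite linearB add_lfunE opp_lfunE linearZ scale_lfunE linearZ scale_lfunE.
      apply/eqP/(scalerI two_neq0); rewrite scaler0 scalerBr 2!scalerA.
      by rewrite -(clifford_past_pair x y nb) xyb linear0.
    case/negP: xLy; rewrite -[x](scalerK gyn); apply: memvZ.
    by rewrite -[_ *: x](subrK (g x n *: y)) memv_add // memvZ ?memv_line.
  by exists (c^-1 *: x), y; rewrite linearZ scale_lfunE xyb scalerA mulVf ?scale1r.
case=> x [z rE].
have le_m : (\dim L <= m)%N by rewrite -dimb dimvS.
(* Orthogonality to [z] and to [x] costs at most two dimensions of [N], and what remains kills x . z
   . beta. *)
have ge_m : (m.-2 <= \dim L)%N.
  have : (\dim (N :&: orthov g <[z]> :&: orthov g <[x]>) <= \dim L)%N.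
    apply: dimvS; apply/subvP => u; rewrite memL !memv_cap !mem_orthov1.
    move=> /andP [/andP [uN /eqP uz] /eqP ux]; apply/andP; split=> [//|].
    rewrite memN'.
    have ub : gs u beta = 0 by apply/eqP; rewrite -memN.
    rewrite rE (clifford_past_pair x z ub) metricC uz (metricC g x) ux.
    by rewrite mulr0 !scale0r subrr.
  have := leq_dim_orthov1 g z N.
  have := leq_dim_orthov1 g x (N :&: orthov g <[z]>)%VS.
  by rewrite dimb; lia.
have ne_m : \dim L <> m.
  move=> dimL; move/negP: yN; apply.
  have LE : L = N' by apply/eqP; rewrite eqEdim LN' dimr dimL leqnn.
  by move: yN'; rewrite -LE memL => /andP [].
(* Otherwise [N'] would kill y . beta, which has the other chirality; so y . beta = 0, although [y]
   lies outside [N]. *)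
have ne_m1 : (\dim L).+1 <> m.
  move=> dimL; move: yN; rewrite memN => /eqP; apply.
  by apply/N'_0/N'_adj; rewrite dimr -dimL.
by split=> //; move: le_m ge_m ne_m ne_m1; lia.
Qed.

End PureSpinors.

(** * Contraction identities and Clifford products *)

Lemma coord_inj (K : fieldType) (W : vectType K) (k : nat) (w : k.-tuple W) x y :
  basis_of fullv w -> (forall i, coord w i x = coord w i y) -> x = y.
Proof.
move=> hw xy; rewrite (coord_basis hw (memvf x)) (coord_basis hw (memvf y)).
by apply: eq_bigr => i _; rewrite xy.
Qed.

Section ContractionCriteria.

Variables (R : realType) (m n p q : nat) (V S T : vectType R[i]) (g : {symmetric V}).
Hypothesis g_nondeg : nondegenerate g.
Variables (gs : 'Hom(V, 'Hom(S, T))) (gt : 'Hom(V, 'Hom(T, S))).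
Hypotheses (cl : clifford_relations g gs gt).
Hypothesis dimST : (\dim {:S} + \dim {:T} = 2 ^ m)%N.
Variables (e : n.-tuple V) (s : p.-tuple S) (t : q.-tuple T).
Hypotheses (he : basis_of fullv e) (hs : basis_of fullv s) (ht : basis_of fullv t).

(** v_A is orthogonal to the plane of [xi], because g(v_A, u) = (u . xi)^A, and this plane is its
    own orthogonal complement. *)
Lemma raised_act_pure xi A : pure m gs xi -> gs (raised_act g e t gs xi A) xi = 0.
Proof.
move=> pxi; apply/eqP; rewrite -mem_spinor_plane.
apply: (orthogonal_spinor_plane g_nondeg cl dimST pxi) => u.
by rewrite mem_spinor_plane raised_actE // => /eqP ->; rewrite linear0.
Qed.

Lemma opposite_contractP alpha beta : pure m gs alpha ->
  (exists v, beta = gs v alpha) <->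
  forall A B, contract (spinor_upper g e s t gs alpha)
                       (spinor_lower g e t s gt beta) A B
              = - 2 * coord s B alpha * coord t A beta.
Proof.
move=> pa; split=> [[v ->] A B|cE].
  (* v_A kills [alpha], so v_A . v . alpha reduces to -2 g(v, v_A) alpha = -2 (v . alpha)^A
     alpha. *)
  rewrite contract_raised // (cliffordC cl) raised_act_pure // linear0 subr0.
  by rewrite linearZ /= metricC raised_actE // !mulNr mulrAC.
have [B aB] : exists B, coord s B alpha != 0.
  apply/existsP; apply: contraNT (proj1 pa); rewrite negb_exists => /forallP a0.
  apply/eqP/(coord_inj hs) => B; rewrite linear0; apply/eqP.
  by have := a0 B; rewrite negbK.
(* With the factor of [beta] raised instead, the identity at this [B] reads w . alpha = -2 alpha^B
   beta. *)
pose w := raised_act g e s gt beta B.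
have wE : gs w alpha = (- 2 * coord s B alpha) *: beta.
  apply: (coord_inj ht) => A; rewrite linearZ /= -cE contractC //.
  by rewrite contract_raised.
exists ((- 2 * coord s B alpha)^-1 *: w); rewrite linearZ scale_lfunE wE scalerA.
by rewrite mulVf ?scale1r // mulf_neq0 // oppr_eq0 pnatr_eq0.
Qed.

(** The v_A span the plane: as it is null, g(v, -) vanishes on it and factors through [c]. The
    coefficients are the values of the factored form on the frame [t], [c^-1] choosing preimages. *)
Lemma spinor_plane_raised beta v : pure m gs beta -> v \in spinor_plane gs beta ->
  exists f : 'I_q -> R[i], v = \sum_A f A *: raised_act g e t gs beta A.
Proof.
move=> pb vN; pose c := act_hom gs beta.
exists (fun A => g v (c^-1%VF t`_A)).
apply: (metric_inj g_nondeg) => u.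
transitivity (g v (c^-1%VF (c u))); last first.
  rewrite [RHS]metricC metric_sumr act_homE.
  rewrite {1}(coord_basis ht (memvf (gs u beta))) linear_sum metric_sumr.
  apply: eq_bigr => A _; rewrite linearZ /= !metricZr.
  rewrite (metricC g u (raised_act _ _ _ _ _ _)) raised_actE //.
  by rewrite mulrC.
have : c^-1%VF (c u) - u \in spinor_plane gs beta.
  rewrite mem_spinor_plane -act_homE -/c linearB subr_eq0; apply/eqP.
  exact/limg_lfunVK/memv_img/memvf.
move/(spinor_plane_null cl (proj1 pb) vN)/eqP.
by rewrite linearB subr_eq0 => /eqP ->.
Qed.

Lemma same_contractP beta rho :
  pure m gs beta -> pure m gs rho -> ~ proportional beta rho ->
  (exists x y, rho = gt x (gs y beta)) <->
  forall A B, symmetrise (contract (spinor_upper g e s t gs beta)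
                                   (spinor_lower g e s t gs rho)) A B = 0.
Proof.
move=> pb pr bNr; split=> [[x [y ->]] A B|cE].
  (* The contraction becomes 2 (y . beta)^A (x . beta)^B - 2 (x . beta)^A (y . beta)^B. *)
  rewrite /symmetrise !contract_raised // !(clifford_past_pair cl) ?raised_act_pure //.
  have coordB C a b u v :
      coord t C (a *: u - b *: v) = a * coord t C u - b * coord t C v.
    by rewrite raddfB; congr (_ - _); apply: linearZ.
  rewrite !coordB !(metricC g _ (raised_act _ _ _ _ _ _)).
  by rewrite !raised_actE //; ring.
have skew A : gs (raised_act g e t gs beta A) rho
    = - gs (raised_act g e t gs rho A) beta.
  apply: (coord_inj ht) => B; rewrite linearN; apply/eqP; rewrite -addr_eq0.
  have /eqP := cE A B; rewrite mulf_eq0 invr_eq0 pnatr_eq0 /=.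
  by rewrite [contract _ _ B A]contractC // !contract_raised.
(* The v_A of [beta] span its plane, so [skew] extends to all of it by linearity. *)
have act_rho v : v \in spinor_plane gs beta -> exists w, gs v rho = gs w beta.
  move=> /(spinor_plane_raised pb) [f ->].
  exists (- \sum_A f A *: raised_act g e t gs rho A).
  rewrite linearN opp_lfunE !linear_sum !sum_lfunE -sumrN; apply: eq_bigr => A _.
  by rewrite !linearZ !scale_lfunE skew scalerN.
have /subvPn [x xN' xN] : ~~ (spinor_plane gs rho <= spinor_plane gs beta)%VS.
  apply/negP => /subvP N'N; apply: bNr.
  apply: (pure_unique g_nondeg cl dimST pr) => u /N'N.
  by rewrite mem_spinor_plane => /eqP.
have : x \notin orthov g (spinor_plane gs beta).
  apply: contra xN => /mem_orthovP.
  exact: (orthogonal_spinor_plane g_nondeg cl dimST pb).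
case/mem_orthovPn => v vN gxv; have [w vw] := act_rho v vN.
(* Since [x] kills [rho], x . w . beta = x . v . rho = -2 g(x,v) rho. *)
exists (- (2 * g x v)^-1 *: x), w.
have xr : gs x rho = 0 by apply/eqP; rewrite -mem_spinor_plane.
have xw : gt x (gs w beta) = - (2 * g x v) *: rho.
  by rewrite -vw (cliffordC cl) xr linear0 subr0 metricC.
rewrite linearZ scale_lfunE xw.
by rewrite scalerA mulrNN mulVf ?scale1r // mulf_neq0 // pnatr_eq0.
Qed.

End ContractionCriteria.

Theorem proposition2p9 (R : realType) (m : nat) (hm : (2 < m)%N)
    (V Sp Sm : vectType R[i])
    (dimV : \dim {:V} = (2 * m)%N)
    (dimSp : \dim {:Sp} = (2 ^ (m - 1))%N)
    (dimSm : \dim {:Sm} = (2 ^ (m - 1))%N)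
    (g : {symmetric V}) (g_nondeg : nondegenerate g)
    (gp : 'Hom(V, 'Hom(Sp, Sm))) (gm : 'Hom(V, 'Hom(Sm, Sp)))
    (gpm : clifford_relations g gp gm)
    (e : (2 * m).-tuple V) (he : basis_of fullv e)
    (s : (2 ^ (m - 1)).-tuple Sp) (hs : basis_of fullv s)
    (t : (2 ^ (m - 1)).-tuple Sm) (ht : basis_of fullv t) :
  (forall (alpha : Sp) (beta : Sm), pure m gp alpha -> pure m gm beta ->
     (null_plane g (m - 1) (spinor_plane gp alpha :&: spinor_plane gm beta)
      <->
      forall (A B' : 'I_(2 ^ (m - 1))),
        contract (spinor_upper g e s t gp alpha)
                 (spinor_lower g e t s gm beta) A B'
        = - 2 * coord s B' alpha * coord t A beta)) /\
  (forall beta rho : Sm, pure m gm beta -> pure m gm rho ->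
     ~ proportional beta rho ->
     (null_plane g (m - 2) (spinor_plane gm beta :&: spinor_plane gm rho)
      <->
      forall (A' B' : 'I_(2 ^ (m - 1))),
        symmetrise (contract (spinor_upper g e t s gm beta)
                             (spinor_lower g e t s gm rho)) A' B' = 0)) /\
  (forall alpha pi : Sp, pure m gp alpha -> pure m gp pi ->
     ~ proportional alpha pi ->
     (null_plane g (m - 2) (spinor_plane gp alpha :&: spinor_plane gp pi)
      <->
      forall (A B : 'I_(2 ^ (m - 1))),
        symmetrise (contract (spinor_upper g e s t gp alpha)
                             (spinor_lower g e s t gp pi)) A B = 0)).
Proof.
have dims : (\dim {:Sp} + \dim {:Sm} = 2 ^ m)%N.
  by rewrite dimSp dimSm addnn -mul2n -expnS subn1 prednK // (ltn_trans _ hm).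
have dims' : (\dim {:Sm} + \dim {:Sp} = 2 ^ m)%N by rewrite addnC.
have gmp := clifford_sym gpm.
have m1 : (1 < m)%N by apply: ltnW.
split=> [alpha beta pa pb|].
  apply: iff_trans (opposite_contractP g_nondeg gpm dims he hs ht beta pa).
  exact: opposite_planes_adjacentP (ltnW m1) pa pb.
split=> [beta rho pb pr bNr|alpha pi pa pp aNp].
  apply: iff_trans (same_contractP g_nondeg gmp dims' he ht hs pb pr bNr).
  exact: same_planes_adjacentP.
apply: iff_trans (same_contractP g_nondeg gpm dims he hs ht pa pp aNp).
exact: same_planes_adjacentP.
Qed.
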